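(* Let $X$ be a finite set, and suppose that $\mathscr{C} \subseteq \binom{X}{3}$ and $\bigcup \mathscr{C} = X$. Then the following three statements are equivalent: (1) There exists a tree $T=(V,E)$ with $X \subseteq V$ for which the function $S \mapsto \mathrm{med}_T(S)$ from $\mathscr{C}$ to $V$ is injective. (2) There exists a tree $T=(V,E)$ with $X$ as its set of leaves, and all its other vertices of degree $3$, for which the function $S \mapsto \mathrm{med}_T(S)$ from $\mathscr{C}$ to the set of interior vertices of $T$ is injective. (3) For all non-empty subsets $\mathscr{C}'$ of $\mathscr{C}$ we have $$\left|\bigcup \mathscr{C}'\right| \geq |\mathscr{C}'| + 2.$$
   Context: Here $\binom{X}{3}$ denotes the set of all $3$-element subsets of $X$, and for a collection $\mathscr{C}$ of sets, $\bigcup \mathscr{C} = \bigcup_{S \in \mathscr{C}} S$. A leaf of a tree is a vertex of degree $1$; an interior vertex is a vertex that is not a leaf. Given a tree $T=(V,E)$ and a $3$-element subset $S=\{x,y,z\}$ of $V$, there is a unique vertex that is shared by the three paths in $T$ connecting $x$ and $y$, connecting $x$ and $z$, and connecting $y$ and $z$. This vertex is called the median vertex of $S$ in $T$ and is denoted $\mathrm{med}_T(S)$. *)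

(* Defs.v *)
From mathcomp Require Import all_boot.
Set Implicit Arguments.
Unset Strict Implicit.
Unset Printing Implicit Defensive.

(* A finite simple graph is a symmetric irreflexive relation [e] on a finite
   type [V] of vertices. *)
Section Trees.
Variables (V : finType) (e : rel V).
Implicit Types (x y z u v : V) (p q : seq V) (S : {set V}).

(* [ucycle e c] also holds for the closed walks [:: x; y] that run back and
   forth along an edge, so only those with at least 3 vertices are cycles.
   The graph without vertices counts as a tree. *)
Definition is_tree : Prop :=
  [/\ symmetric e, irreflexive e, (forall x y, connect e x y)
    & forall c : seq V, ucycle e c -> size c < 3].

Definition degree v : nat := #|[set w | e v w]|.
Definition leaves : {set V} := [set v | degree v == 1].
Definition interior : {set V} := ~: leaves.

Definition simple_path x y p : bool :=
  [&& path e x p, last x p == y & uniq (x :: p)].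

(* [v] lies on a simple path from [x] to [y]; the bound on the length of the
   path loses nothing, see [on_pathP]. *)
Definition on_path x y v : bool :=
  [exists n : 'I_#|V|, exists p : n.-tuple V,
     simple_path x y p && (v \in x :: p)].

Definition is_median S v : bool :=
  [forall x in S, forall y in S, (x != y) ==> on_path x y v].

(* By [med_tree] below, [med S] is [Some v] for exactly one [v] as soon as the
   graph is a tree and [S] has 3 elements. *)
Definition med S : option V := [pick v | is_median S v].

Lemma on_pathP x y v :
  reflect (exists2 p, simple_path x y p & v \in x :: p) (on_path x y v).
Proof.
apply: (iffP existsP) => [[n /existsP[p /andP[]]]|[p xyp vp]]; first by exists p.
have lt_p : size p < #|V|.
  case/and3P: xyp => _ _ /card_uniqP up.
  by have := max_card (mem (x :: p)); rewrite up.
by exists (Ordinal lt_p); apply/existsP; exists (in_tuple p); rewrite xyp.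
Qed.

Hypothesis treeV : is_tree.

Lemma simple_path_rev x y p :
  simple_path x y p -> simple_path y x (rev (belast x p)).
Proof.
case: treeV => esym _ _ _ /and3P[ep /eqP yE up]; apply/and3P; split.
- rewrite -yE rev_path; apply: etrans ep.
  by apply: eq_path => u v; rewrite esym.
- by case: (p) yE => [|a q] /= yE; rewrite ?yE // rev_cons last_rcons.
- by rewrite -yE -rev_rcons -lastI rev_uniq.
Qed.

Lemma on_pathC x y v : on_path x y v = on_path y x v.
Proof.
suff sub a b : on_path a b v -> on_path b a v by apply/idP/idP; apply: sub.
case/on_pathP=> p xyp vp; apply/on_pathP.
exists (rev (belast a p)); first exact: simple_path_rev.
by case/and3P: xyp => _ /eqP <- _; rewrite -rev_rcons -lastI mem_rev.
Qed.

Lemma simple_path_inj x y p q :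
  simple_path x y p -> simple_path x y q -> p = q.
Proof.
case: treeV => esym eirr econn acyc.
rewrite /simple_path; elim: p x q => [|a p IHp] x [|b q] //.
- case/and3P=> _ /= /eqP <- _ /and3P[_ /= /eqP lq /andP[/negP xq _]].
  by case: xq; rewrite -{1}lq mem_last.
- case/and3P=> _ /= /eqP lp /andP[/negP xp _] /andP[/eqP xy _].
  by case: xp; rewrite xy -{1}lp mem_last.
case/and3P=> /= /andP[xa ep] lp /andP[xp up] /and3P[/= /andP[xb eq] lq /andP[xq uq]].
case: (eqVneq a b) => [ab|neq_ab].
  by rewrite -ab in eq lq uq *; congr (_ :: _); apply: (IHp a q); apply/and3P.
pose f := [rel u v | [&& e u v, u != x & v != x]].
have fsym : connect_sym f.
  by apply: sym_connect_sym => u v /=; rewrite esym [X in _ && X]andbC.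
have fcon c r : path e c r -> x \notin c :: r -> connect f c (last c r).
  move=> er xr; apply/connectP; exists r => //.
  elim: r c er xr => //= d r IHr c /andP[cd er].
  rewrite !inE !negb_or => /and3P[xc xd xr].
  by rewrite cd ![_ == x]eq_sym xc xd IHr // inE negb_or xd.
have : connect f a b.
  apply: connect_trans (fcon _ _ ep xp) _.
  by rewrite (eqP lp) -(eqP lq) fsym fcon.
case/connectP=> r0 fr0 bE.
case/shortenP: fr0 bE => r fr ur _ bE.
have xr : x \notin a :: r.
  case: (r) fr bE => [|d s] /= fr bE; first by rewrite bE eqxx in neq_ab.
  elim: s a d fr {xa ep lp xp up bE neq_ab ur} => [|c s IHs] a' d /=.
    by rewrite andbT !inE !negb_or ![x == _]eq_sym => /and3P[_ -> ->].
  case/andP=> /and3P[_ na _] /IHs; rewrite !(inE, negb_or) => /and3P[-> -> ->].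
  by rewrite eq_sym na.
have er : path e a r by apply: sub_path fr => u v /= /andP[].
have := acyc (x :: a :: r).
case: r {fr} ur bE xr er => [|d s] ur bE xr er; first by rewrite bE eqxx in neq_ab.
move=> acy; suff: ucycle e [:: x, a, d & s] by move/acy.
rewrite /ucycle cons_uniq xr ur andbT (cycle_path x) /= xa.
by move: er xb => /= ->; rewrite bE esym => ->.
Qed.

Lemma simple_pathE x y p v :
  simple_path x y p -> on_path x y v = (v \in x :: p).
Proof.
move=> xyp; apply/on_pathP/idP => [[q xyq]|]; last by exists p.
by rewrite (simple_path_inj xyp xyq).
Qed.

Lemma simple_path_exists x y : exists p, simple_path x y p.
Proof.
case: treeV => _ _ /(_ x y)/connectP[p ep ->] _.
by case/shortenP: ep => q eq uq _; exists q; rewrite /simple_path eq uq eqxx.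
Qed.

Lemma simple_path_cat x y p1 p2 :
  simple_path x y (p1 ++ p2) ->
  simple_path x (last x p1) p1 /\ simple_path (last x p1) y p2.
Proof.
case/and3P; rewrite cat_path last_cat -cat_cons cat_uniq => /andP[e1 e2] l2.
case/and3P=> u1 dis u2; rewrite /simple_path e1 eqxx u1 e2 l2 /= u2 andbT.
by split=> //; apply: contra dis => lp2; apply/hasP; exists (last x p1); rewrite ?mem_last.
Qed.

Lemma on_path_id x v : on_path x x v -> v = x.
Proof.
have xx : simple_path x x [::] by rewrite /simple_path /= eqxx.
by rewrite (simple_pathE _ xx) mem_seq1 => /eqP.
Qed.

Lemma on_path_cases x y u v :
  on_path x y u -> on_path x y v -> on_path x u v \/ on_path u y v.
Proof.
have [p xyp] := simple_path_exists x y; rewrite !(simple_pathE _ xyp) => up.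
case/splitPl: up xyp => p1 p2 <- /simple_path_cat[xu uy].
rewrite -cat_cons mem_cat (simple_pathE _ xu) (simple_pathE _ uy).
by case/orP=> vI; [left | right]; rewrite // in_cons vI orbT.
Qed.

Lemma on_path_trans x y u v : on_path x y u -> on_path x u v -> on_path v y u.
Proof.
have [p xyp] := simple_path_exists x y; rewrite (simple_pathE _ xyp) => up.
case/splitPl: up xyp => p1 p2 uE xyp; have [xu _] := simple_path_cat xyp.
rewrite uE in xu; rewrite (simple_pathE _ xu) => vp.
case/splitPl: vp xu uE xyp => p3 p4 <- _ uE; rewrite -catA.
case/simple_path_cat=> _ vy; rewrite (simple_pathE _ vy).
by rewrite -uE last_cat -cat_cons mem_cat mem_last.
Qed.

Lemma on_path_antisym z u v : on_path u z v -> on_path v z u -> u = v.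
Proof.
move=> uzv vzu; apply/esym/on_path_id.
by apply: (@on_path_trans z); rewrite on_pathC.
Qed.

Lemma median_unique x y z u v :
  on_path x y u -> on_path x z u -> on_path y z u ->
  on_path x y v -> on_path x z v -> on_path y z v -> u = v.
Proof.
move=> xyu xzu yzu xyv xzv yzv.
wlog xuv : x y xyu xzu yzu xyv xzv yzv / on_path x u v.
  move=> H; case: (on_path_cases xyu xyv) => [xuv|uyv]; first exact: (H x y).
  by apply: (H y x); rewrite // on_pathC.
apply: (@on_path_antisym z); last exact: on_path_trans xzu xuv.
apply: on_path_trans yzv _; rewrite on_pathC; exact: on_path_trans xyu xuv.
Qed.

Lemma gate_on_path x y z v p r :
    simple_path x y p -> v \in x :: p -> simple_path z v r ->
    {in z :: r, forall w, w \in x :: p -> w = v} ->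
  on_path z y v.
Proof.
move=> xyp vp; case/splitPl: vp xyp => p1 p2 vE /and3P[].
rewrite cat_path last_cat vE -cat_cons cat_uniq => /andP[_ e2] l2.
case/and3P=> _ dis u2 /and3P[er /eqP lr ur] gate.
have vNp2 : v \notin p2.
  by apply: contra dis => vp2; apply/hasP; exists v; rewrite // -vE mem_last.
apply/on_pathP; exists (r ++ p2); last by rewrite -cat_cons mem_cat -{1}lr mem_last.
rewrite /simple_path cat_path last_cat lr er e2 l2 -cat_cons cat_uniq ur u2 /= andbT.
apply/hasPn=> w wp2; apply: contra vNp2 => wr.
by rewrite -(gate w wr) // mem_cat wp2 orbT.
Qed.

Lemma median_exists x y z :
  exists v, [/\ on_path x y v, on_path x z v & on_path y z v].
Proof.
have [p xyp] := simple_path_exists x y.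
suff [v [r [vp zvr gate]]] : exists v r, [/\ v \in x :: p, simple_path z v r
    & {in z :: r, forall w, w \in x :: p -> w = v}].
  have mem_p w : w \in y :: rev (belast x p) = (w \in x :: p).
    by case/and3P: xyp => _ /eqP <- _; rewrite -rev_rcons -lastI mem_rev.
  exists v; rewrite (simple_pathE _ xyp) vp; split=> //; rewrite on_pathC.
    apply: gate_on_path (simple_path_rev xyp) _ zvr _; rewrite ?mem_p //.
    by move=> w /gate; rewrite mem_p.
  exact: gate_on_path xyp vp zvr gate.
have [q zxq] := simple_path_exists z x.
suff [v [r [vp zvr _ gate]]] : exists v r, [/\ v \in x :: p, simple_path z v r,
    {subset r <= q} & {in z :: r, forall w, w \in x :: p -> w = v}].
  by exists v, r.
elim: q z zxq => [|a q IHq] z zxq.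
  case/and3P: zxq => _ /= /eqP -> _; exists x, [::].
  rewrite /simple_path /= eqxx mem_head; split=> // w.
  by rewrite mem_seq1 => /eqP.
have [zp|zNp] := boolP (z \in x :: p).
  exists z, [::]; rewrite /simple_path /= eqxx; split=> // w.
  by rewrite mem_seq1 => /eqP.
case/and3P: zxq => /= /andP[za eq] lq /andP[zNq uq].
have [|v [r [vp /and3P[er lr ur] rq gate]]] := IHq a; first exact/and3P.
have sub : {subset a :: r <= a :: q}.
  by move=> w; rewrite !inE => /orP[->|/rq->] //; rewrite orbT.
exists v, (a :: r); split=> //.
  by rewrite /simple_path /= za er lr (contra (sub z) zNq).
by move=> w; rewrite inE => /orP[/eqP->|/gate //]; rewrite (negPf zNp).
Qed.

Lemma is_median3 x y z v : x != y -> x != z -> y != z ->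
  is_median [set x; y; z] v = [&& on_path x y v, on_path x z v & on_path y z v].
Proof.
move=> xy xz yz; apply/idP/and3P => [H|[xyv xzv yzv]].
  have med_on a b : a \in [set x; y; z] -> b \in [set x; y; z] -> a != b ->
      on_path a b v.
    by move=> aS bS; move/forall_inP/(_ a aS)/forall_inP/(_ b bS)/implyP: H; apply.
  by split; apply: med_on; rewrite ?inE ?eqxx ?orbT.
apply/forall_inP=> a aS; apply/forall_inP=> b bS; apply/implyP.
move: aS bS; rewrite !inE -!orbA.
by case/or3P=> /eqP-> /or3P[] /eqP-> //; rewrite ?eqxx // on_pathC.
Qed.

Lemma med_tree S : #|S| = 3 ->
  exists2 v, med S = Some v & forall u, is_median S u = (u == v).
Proof.
move=> S3; have [x [y [z [xy xz yz ->]]]] : exists x y z,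
    [/\ x != y, x != z, y != z & S = [set x; y; z]].
  have /card_gt2P[x [y [z [[xS yS zS] [xy yz zx]]]]] : 2 < #|S| by rewrite S3.
  rewrite eq_sym in zx; exists x, y, z; split=> //; apply/esym/eqP.
  rewrite eqEcard S3 !subUset !sub1set xS yS zS /= -setUA cardsU1 cards2.
  by rewrite !inE negb_or xy yz zx.
have [v vmed] := median_exists x y z.
have medE u : is_median [set x; y; z] u = (u == v).
  rewrite is_median3 //; apply/and3P/eqP => [[xyu xzu yzu]|-> //].
  by case: vmed; apply: median_unique.
exists v => //; rewrite /med; case: pickP => [u|/(_ v)]; rewrite medE ?eqxx //.
by move/eqP->.
Qed.
End Trees.

(* Main.v *)
(* Adding a vertex [z] to a set [Y] of vertices of a tree creates at most one
   new median of triples, so [Y] has at most [#|Y| - 2] medians; applied to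
   [Y := cover C'] this gives (1) => (3).
   Conversely, Hall's condition (3) bounds [#|C|] by [#|X| - 2], so some [x] lies
   in at most two triples.  Merge [x] into a well-chosen [c] and delete the
   triple that contains both (if any): since the tight subfamilies (those with
   equality in (3)) are closed under unions of intersecting pairs, [c] can be
   chosen so that (3) survives.  In a tree for the smaller family, hang two new
   leaves, standing for [x] and [c], below the old leaf [c], which becomes the
   median of the deleted triple; no other median moves. *)

Require Import Defs.
From mathcomp Require Import all_boot zify.
Set Implicit Arguments.
Unset Strict Implicit.
Unset Printing Implicit Defensive.

Lemma cards3E (T : finType) (S : {set T}) x : #|S| = 3 -> x \in S ->
  exists y z, [/\ x != y, x != z, y != z & S = [set x; y; z]].
Proof.
move=> S3 xS; have /cards2P[y [z [yz SE]]] : #|S :\ x| == 2.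
  by have := cardsD1 x S; rewrite S3 xS add1n => -[<-].
exists y, z; have : x \notin S :\ x by rewrite !inE eqxx.
rewrite SE !inE negb_or => /andP[xy xz]; split=> //.
by rewrite -(setD1K xS) SE setUA.
Qed.

(** * Paths and medians in a fixed tree; counting the medians of a vertex set *)

Section TreeMedians.
Variables (V : finType) (e : rel V).
Hypothesis treeV : is_tree e.
Implicit Types (x y z u v w : V) (S Y : {set V}).

Lemma on_path_left x y : on_path e x y x.
Proof.
by have [p xyp] := simple_path_exists treeV x y; apply/on_pathP; exists p; rewrite ?mem_head.
Qed.

Lemma on_path_right x y : on_path e x y y.
Proof. by rewrite (on_pathC treeV) on_path_left. Qed.

Lemma on_path_sub x y u v : on_path e x y u -> on_path e x u v -> on_path e x y v.
Proof.
have [p xyp] := simple_path_exists treeV x y; rewrite !(simple_pathE treeV _ xyp) => up.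
case/splitPl: up xyp => p1 p2 <- /simple_path_cat[xu _].
by rewrite (simple_pathE treeV _ xu) -cat_cons mem_cat => ->.
Qed.

(** The median [m] of [x], [y], [z] cuts the path from [x] to [y] into two pieces, each of which
    begins a path to [z]. *)
Lemma on_path_split x y z v : on_path e x y v -> on_path e x z v \/ on_path e y z v.
Proof.
have [m [xym xzm yzm]] := median_exists treeV x y z.
move=> xyv; case: (on_path_cases treeV xym xyv) => vm; [left|right].
  exact: on_path_sub xzm vm.
by apply: on_path_sub yzm _; rewrite (on_pathC treeV).
Qed.

(** Any other vertex of the path has a predecessor and a successor on it; for a leaf these would be
    the same neighbour, and the path would repeat a vertex. *)
Lemma leaf_on_path x y v : v \in leaves e -> on_path e x y v -> v = x \/ v = y.
Proof.
case: (treeV) => esym _ _ _.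
rewrite inE => /cards1P[w vN] /on_pathP[p xyp vp].
have nbr u : e v u -> u = w by move=> vu; apply/set1P; rewrite -vN inE.
case: (eqVneq v x) => [|vx]; [by left|right].
move: vp xyp; rewrite inE (negPf vx) /= => vp.
case/splitPr: vp => p1 [|b p2]; case/and3P; first by rewrite last_cat /= => _ /eqP.
rewrite cat_path -cat_cons cat_uniq => /and4P[_ lv vb _] _ /and3P[_ dis _].
case/hasP: dis; exists b; first by rewrite !inE eqxx orbT.
by rewrite (nbr _ vb) -(nbr (last x p1)) ?mem_last // esym.
Qed.

(** A leaf on all three paths would be an end of each, but no vertex belongs to all three pairs of a
    triple. *)
Lemma triple_median S v : #|S| = 3 ->
  (forall a b, a \in S -> b \in S -> a != b -> on_path e a b v) -> v \in interior e.
Proof.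
move=> S3 Sv; rewrite inE; apply/negP => vL.
have [x xS] : exists x, x \in S by apply/set0Pn; rewrite -card_gt0 S3.
have [y [z [xy xz yz SE]]] := cards3E S3 xS.
have [vx|vy] : v = x \/ v = y.
- by apply: leaf_on_path vL (Sv _ _ _ _ xy); rewrite SE !inE eqxx ?orbT.
- have [] : v = y \/ v = z.
  + by apply: leaf_on_path vL (Sv _ _ _ _ yz); rewrite SE !inE eqxx ?orbT.
  + by move=> vy; rewrite -vx vy eqxx in xy.
  + by move=> vz; rewrite -vx vz eqxx in xz.
- have [] : v = x \/ v = z.
  + by apply: leaf_on_path vL (Sv _ _ _ _ xz); rewrite SE !inE eqxx ?orbT.
  + by move=> vx; rewrite -vy vx eqxx in xy.
  + by move=> vz; rewrite -vy vz eqxx in yz.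
Qed.

Definition medians Y : {set V} :=
  [set v | [exists S : {set V}, [&& S \subset Y, #|S| == 3 & is_median e S v]]].

Lemma mem_medians Y x y z v :
    x \in Y -> y \in Y -> z \in Y -> x != y -> x != z -> y != z ->
    on_path e x y v -> on_path e x z v -> on_path e y z v ->
  v \in medians Y.
Proof.
move=> xY yY zY xy xz yz xyv xzv yzv; rewrite inE; apply/existsP.
exists [set x; y; z]; rewrite !subUset !sub1set xY yY zY is_median3 // xyv xzv yzv.
by rewrite -setUA cardsU1 cards2 !inE negb_or xy xz yz.
Qed.

(* Two medians [u], [v] of triples through [z]: if [u] is not between [z] and
   [v], then [x] or [y], whichever is on the far side of [v] from [u], can
   replace [z] in the triple of [u]. *)
Lemma median_replace Y x y z x' y' u v : u != v ->
    x \in Y -> y \in Y -> x' \in Y -> y' \in Y -> x' != y' ->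
    on_path e x' y' u -> on_path e x' z u -> on_path e y' z u ->
    on_path e x y v -> ~~ on_path e z v u ->
  u \in medians Y.
Proof.
move=> uv xY yY xY' yY' xy' u1 u2 u3 v1 uNzv.
have far a : on_path e a z u -> on_path e a v u.
  by case/(on_path_split v) => //; rewrite (negPf uNzv).
have [w wY uNwv] : exists2 w, w \in Y & ~~ on_path e w v u.
  have [xvu|] := boolP (on_path e x v u); last by exists x.
  have [yvu|] := boolP (on_path e y v u); last by exists y.
  (* Here [u] lies between [v] and each of [x], [y], while [v], being on the path from [x] to [y],
     lies between [u] and one of them. *)
  have [] := on_path_split u v1 => H; case/eqP: uv.
    by apply: (on_path_antisym treeV (z := x)); rewrite (on_pathC treeV).
  by apply: (on_path_antisym treeV (z := y)); rewrite (on_pathC treeV).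
have near a : on_path e a z u -> on_path e a w u.
  by move/far/(on_path_split w) => [] //; rewrite (on_pathC treeV) (negPf uNwv).
have wN a : on_path e a z u -> a != w.
  by move=> /far; apply: contraTneq => ->.
apply: (@mem_medians Y x' y' w); rewrite ?wN ?near //.
Qed.

(** Triples of new medians [u], [v] contain [z]. By [median_replace], [u] lies between [z] and [v],
    and [v] between [z] and [u], so antisymmetry identifies them. *)
Lemma mediansD1 Y z : #|medians Y :\: medians (Y :\ z)| <= 1.
Proof.
have decomp v : v \in medians Y :\: medians (Y :\ z) -> exists x y,
    [/\ x \in Y :\ z, y \in Y :\ z, x != y &
     [/\ on_path e x y v, on_path e x z v & on_path e y z v]].
  case/setDP; rewrite !inE => /existsP[S /and3P[SY /eqP S3 Sv]] /existsPn/(_ S).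
  rewrite S3 Sv !andbT subsetD1 SY negbK /= => zS.
  have [x [y [zx zy xy SE]]] := cards3E S3 zS.
  move: Sv SY; rewrite SE is_median3 // !subUset !sub1set => /and3P[zxv zyv xyv].
  case/andP=> /andP[_ xY] yY; exists x, y.
  by rewrite !in_setD1 xY yY eq_sym zx eq_sym zy !(on_pathC treeV _ z) zxv zyv.
apply/card_le1_eqP => u v uM vM.
apply/esym/eqP/negPn/negP => uv; have [x [y [xY yY xy [u1 u2 u3]]]] := decomp _ uM.
have [x' [y' [xY' yY' xy' [v1 v2 v3]]]] := decomp _ vM.
have [zvu|zvu] := boolP (on_path e z v u); last first.
  have := median_replace uv xY' yY' xY yY xy u1 u2 u3 v1 zvu.
  by case/setDP: uM => _ /negP.
have [zuv|zuv] := boolP (on_path e z u v).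
  by case/eqP: uv; apply: (on_path_antisym treeV (z := z)); rewrite (on_pathC treeV).
have := median_replace _ xY yY xY' yY' xy' v1 v2 v3 u1 zuv.
by case/setDP: vM => _ /negP nv; rewrite eq_sym => /(_ uv).
Qed.

Lemma card_medians Y : 1 < #|Y| -> #|medians Y| + 2 <= #|Y|.
Proof.
move En: #|Y| => [|[|n]] // _; elim: n Y En => [|n IHn] Y Yn.
  (* A two-point set contains no triple, whence the 2 in the bound. *)
  rewrite [medians Y](_ : _ = set0) ?cards0 //; apply/setP=> v; rewrite !inE.
  apply/existsP=> -[S /and3P[/subset_leq_card]]; rewrite Yn => S2 /eqP S3.
  by rewrite S3 in S2.
have [z zY] : exists z, z \in Y by apply/set0Pn; rewrite -card_gt0 Yn.
have Yz : #|Y :\ z| = n.+2 by have := cardsD1 z Y; rewrite Yn zY add1n => -[].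
have := IHn _ Yz; have := mediansD1 Y z.
have := cardsID (medians (Y :\ z)) (medians Y).
have := subset_leq_card (subsetIr (medians Y) (medians (Y :\ z))).
lia.
Qed.

Lemma card_med_injective (C : {set {set V}}) : C != set0 ->
    {in C, forall S : {set V}, #|S| = 3} -> {in C &, injective (med e)} ->
  #|C| + 2 <= #|cover C|.
Proof.
move=> /set0Pn[S0 S0C] C3 inj.
have le3 : 2 < #|cover C| by rewrite -(C3 _ S0C) subset_leq_card ?(bigcup_sup S0).
apply: leq_trans (card_medians (ltnW le3)); rewrite leq_add2r.
rewrite -(card_in_imset inj) -(card_imset _ (@Some_inj _ : injective (@Some V))) subset_leq_card //.
apply/subsetP=> _ /imsetP[S SC ->]; have [v -> vS] := med_tree treeV (C3 _ SC).
rewrite mem_imset ?inE; last exact: Some_inj.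
by apply/existsP; exists S; rewrite (bigcup_sup S) // C3 // eqxx vS eqxx.
Qed.
End TreeMedians.

(** * Hanging new leaves on a vertex of a tree *)

Definition pendant (V : finType) (e : rel V) (c : V) : rel (option V) :=
  fun u w => match u, w with
    | Some a, Some b => e a b
    | Some a, None => a == c
    | None, Some b => b == c
    | None, None => false
    end.

Section Pendant.
Variables (V : finType) (e : rel V) (c : V).
Hypothesis treeV : is_tree e.
Notation e' := (pendant e c).

Lemma pendant_tree : is_tree e'.
Proof.
case: (treeV) => esym eirr econn acyc.
have conS a b : connect e' (Some a) (Some b).
  have /connectP[p ep ->] := econn a b; apply/connectP; exists (map Some p).
    by rewrite path_map.
  by rewrite last_map.
have c1 : connect e' (Some c) None by apply: connect1; rewrite /= eqxx.
have c2 : connect e' None (Some c) by apply: connect1; rewrite /= eqxx.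
split=> [[a|] [b|] //=|[a|] //=|[a|] [b|]|p pc].
- exact: conS.
- exact: connect_trans (conS a c) c1.
- exact: connect_trans c2 (conS c b).
- exact: connect0.
have [pN|pN] := boolP (None \in p); last first.
  have [q pE] : exists q, p = map Some q.
    exists (pmap id p); elim: (p) pN => [|[a|] q IHq] //=.
    by rewrite in_cons /= => /IHq <-.
  rewrite pE size_map; apply: acyc; move: pc; rewrite pE /ucycle.
  rewrite (map_inj_uniq (@Some_inj _)) => /andP[cq ->]; rewrite andbT.
  by move: cq; rewrite (mono_cycle (e := e)).
(* Rotated to start at [None], a closed walk with at least three vertices has [Some c] both second
   and last, so it is not duplicate-free. *)
have [i q rE] := rot_to pN.
move: pc; rewrite -(size_rot i) -(rot_ucycle i) rE.
case/lastP: q {rE} => [|q b] //; case: q => [|a q] //= /andP[].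
rewrite (cycle_path None) /= last_rcons mem_rcons !in_cons.
by case: a b => [a|] [b|] //= /and3P[/eqP<- /eqP->]; rewrite eqxx /= andbF.
Qed.

Lemma pendant_onSS x y v : on_path e' (Some x) (Some y) (Some v) = on_path e x y v.
Proof.
have [p xyp] := simple_path_exists treeV x y; rewrite (simple_pathE treeV _ xyp).
have xyp' : simple_path e' (Some x) (Some y) (map Some p).
  case/and3P: xyp => ep /eqP <- up; rewrite /simple_path path_map ep last_map eqxx.
  by rewrite -map_cons map_inj_uniq //; apply: Some_inj.
rewrite (simple_pathE pendant_tree _ xyp') -map_cons mem_map //; exact: Some_inj.
Qed.

Lemma pendant_onNS y v : on_path e' None (Some y) (Some v) = on_path e c y v.
Proof.
have [p xyp] := simple_path_exists treeV c y; rewrite (simple_pathE treeV _ xyp).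
have xyp' : simple_path e' None (Some y) (map Some (c :: p)).
  case/and3P: xyp => ep /eqP <- up; rewrite /simple_path cons_uniq.
  rewrite (map_inj_uniq (@Some_inj _)) up /= eqxx path_map ep last_map eqxx andbT.
  by rewrite in_cons /=; elim: (p).
rewrite (simple_pathE pendant_tree _ xyp') in_cons mem_map //; exact: Some_inj.
Qed.

Lemma pendant_degS v : degree e' (Some v) = degree e v + (v == c).
Proof.
have NNone (A : {set V}) : (None \in Some @: A) = false.
  by apply/negP=> /imsetP[z _].
rewrite {1}/degree.
have -> : [set w | e' (Some v) w] =
    (if v == c then [set None] else set0) :|: Some @: [set w | e v w].
  apply/setP=> -[w|]; rewrite !inE ?NNone ?orbF.
    by rewrite mem_imset ?inE; [case: ifP; rewrite !inE | apply: Some_inj].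
  by case: ifP; rewrite !inE.
rewrite cardsU (_ : _ :&: _ = set0) ?cards0 ?subn0; last first.
  by apply/setP=> -[w|]; rewrite !inE ?NNone ?andbF //; case: eqP; rewrite ?inE.
rewrite card_imset 1?[LHS]addnC; last exact: Some_inj.
by case: eqP; rewrite ?cards1 ?cards0.
Qed.

Lemma pendant_degN : degree e' None = 1.
Proof.
rewrite /degree -[RHS](cards1 (Some c)); apply: eq_card => -[w|]; rewrite !inE //=.
Qed.
End Pendant.

Section Cherry.
Variables (V : finType) (e : rel V) (c : V).
Hypothesis treeV : is_tree e.

Definition cherry : rel (option (option V)) := pendant (pendant e c) (Some c).

(** The old vertex at which a path starting from [u] enters the old tree. *)
Definition collapse (u : option (option V)) : V :=
  if u is Some (Some a) then a else c.

Lemma cherry_tree : is_tree cherry.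
Proof. by do 2!apply: pendant_tree. Qed.

(** A path leaves a new leaf through [c] and then follows the old tree. Equal ends are excluded
    because the trivial path at a new leaf misses [c]. *)
Lemma cherry_on_path u w v : u != w ->
  on_path cherry u w (Some (Some v)) = on_path e (collapse u) (collapse w) v.
Proof.
have tree1 := pendant_tree c treeV; have tree2 := cherry_tree.
have symN a : on_path (pendant e c) (Some a) None (Some v) = on_path e c a v.
  by rewrite (on_pathC tree1) pendant_onNS.
pose simp := (pendant_onSS _ tree1, pendant_onNS _ tree1,
  pendant_onSS _ treeV, pendant_onNS _ treeV, symN).
case: u w => [[a|]|] [[b|]|] // _; rewrite ?simp //=.
- by rewrite (on_pathC treeV).
- by rewrite (on_pathC tree2) !simp (on_pathC treeV).
- by rewrite (on_pathC tree2) !simp.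
Qed.

Lemma cherry_deg u :
  degree cherry u = if u is Some (Some v) then degree e v + (v == c).*2 else 1.
Proof.
case: u => [[v|]|]; rewrite ?pendant_degN // !pendant_degS ?pendant_degN //.
by rewrite (inj_eq (@Some_inj _)) -addnA addnn.
Qed.
End Cherry.

(** * Hall's condition and the merging of two points *)

Section Contraction.
Variables (X I : finType).
Implicit Types (x y c d : X) (Y : {set X}) (i j : I) (J K L : {set I}) (S : I -> {set X}).

(** Indexing the family by [I] leaves [#|K|] unchanged when merging alters the sets. *)
Definition hall J S : bool :=
  [forall K : {set I}, (K \subset J) && (K != set0) ==>
     (#|K| + 2 <= #|\bigcup_(i in K) S i|)].

Lemma hallP J S : reflect (forall K, K \subset J -> K != set0 ->
  #|K| + 2 <= #|\bigcup_(i in K) S i|) (hall J S).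
Proof.
apply: (iffP forallP) => H K; last by apply/implyP=> /andP[KJ K0]; apply: H.
by move=> KJ K0; apply: (implyP (H K)); rewrite KJ.
Qed.

Definition merge x c y : X := if y == x then c else y.

Lemma merge_inj_in x c (A : {set X}) :
  ~~ ((x \in A) && (c \in A)) -> {in A &, injective (merge x c)}.
Proof.
move=> xcA a b aA bA; rewrite /merge; case: eqP => [ax|_]; case: eqP => [bx|_] //.
- by rewrite ax bx.
- by move=> cb; rewrite cb -ax aA bA in xcA.
- by move=> ac; rewrite -ac -bx aA bA in xcA.
Qed.

Lemma merge_imset_id x c (A : {set X}) : x \notin A -> merge x c @: A = A.
Proof.
move=> xA; rewrite -[RHS]imset_id; apply: eq_in_imset => y yA; rewrite /merge.
by case: eqP => // yx; rewrite -yx yA in xA.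
Qed.

Lemma merge_imset x c (A : {set X}) : x \in A -> merge x c @: A = c |: A :\ x.
Proof.
move=> xA; rewrite -{1}(setD1K xA) imsetU1 {1}/merge eqxx merge_imset_id //.
by rewrite !inE eqxx.
Qed.

Lemma bigcup_imset (f : X -> X) K S :
  \bigcup_(i in K) f @: S i = f @: \bigcup_(i in K) S i.
Proof.
by rewrite (big_morph _ (imsetU f) (imset0 f)).
Qed.

(* Merging loses a point of the union of a subfamily only if it contains both
   [x] and [c]; so Hall's condition survives unless the subfamily was tight. *)
Lemma hall_merge x c J S : hall J S -> x != c ->
  hall J (fun i => merge x c @: S i) \/
  exists K, [/\ K \subset J, x \in \bigcup_(i in K) S i,
     c \in \bigcup_(i in K) S i & #|\bigcup_(i in K) S i| <= #|K| + 2].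
Proof.
move=> /hallP hJ xc; case: (boolP (hall _ _)) => [|/forallPn[K]]; [by left|].
rewrite negb_imply bigcup_imset -ltnNge => /andP[/andP[KJ K0] lt]; right; exists K.
have := hJ K KJ K0; set U := \bigcup_(i in K) S i in lt *.
have [xU|xU] := boolP (x \in U); last by rewrite merge_imset_id // in lt; lia.
rewrite merge_imset // cardsU1 !inE eq_sym xc /= in lt.
have := cardsD1 x U; rewrite xU; case: (c \in U) lt => /=; last by lia.
by split=> //; lia.
Qed.

Lemma hallS J K S : K \subset J -> hall J S -> hall K S.
Proof.
move=> KJ /hallP hJ; apply/hallP=> L LK; apply: hJ; exact: subset_trans KJ.
Qed.

(** Submodularity: the two unions meet in at least the union over [K :&: L], which Hall's condition
    bounds below by [#|K :&: L| + 2]; inclusion-exclusion does the rest. *)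
Lemma tightU J K L S : hall J S -> K \subset J -> L \subset J -> K :&: L != set0 ->
    #|\bigcup_(i in K) S i| <= #|K| + 2 -> #|\bigcup_(i in L) S i| <= #|L| + 2 ->
  #|\bigcup_(i in K :|: L) S i| <= #|K :|: L| + 2.
Proof.
move=> /hallP hJ KJ LJ KL0; rewrite bigcup_setU.
have := hJ (K :&: L) (subset_trans (subsetIl _ _) KJ) KL0.
have : \bigcup_(i in K :&: L) S i \subset
       (\bigcup_(i in K) S i) :&: (\bigcup_(i in L) S i).
  apply/bigcupsP=> i; rewrite inE => /andP[iK iL].
  by rewrite subsetI !(bigcup_sup i).
move/subset_leq_card; rewrite !cardsU.
have := subset_leq_card (subsetIl K L).
have := subset_leq_card (subsetIl (\bigcup_(i in K) S i) (\bigcup_(i in L) S i)).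
lia.
Qed.

(** At most one triple may contain both points, since the old leaf [c] can serve as the median of
    only one deleted triple. *)
Definition contractible Y J S x c : Prop :=
  [/\ x \in Y, c \in Y, x != c,
    {in [set i in J | (x \in S i) && (c \in S i)] &, forall i j, i = j} &
    hall [set i in J | ~~ ((x \in S i) && (c \in S i))] (fun i => merge x c @: S i)].

(** If [x] lies in at most one triple, [easy] suffices. If it lies in [S i1] and [S i2], two
    candidates from [S i2] are considered; were both to fail, their tight obstructions would unite
    to cover [S i2]. *)
Lemma hall_contract Y J S : 2 < #|Y| -> {in J, forall i, #|S i| = 3} ->
    {in J, forall i, S i \subset Y} -> hall J S ->
  exists x c, contractible Y J S x c.
Proof.
move=> Y3 S3 SY hJ.
have [x xY deg2] : exists2 x, x \in Y & #|[set i in J | x \in S i]| <= 2.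
  have [J0|[i0 i0J]] := set_0Vmem J.
    have [x xY] : exists x, x \in Y by apply/set0Pn; rewrite -card_gt0; lia.
    exists x; rewrite // J0 (_ : [set i in _ | _] = set0) ?cards0 //.
    by apply/setP=> i; rewrite !inE.
  apply/exists_inP; apply: contraT; rewrite negb_exists_in => /forall_inP big.
  suff: False by [].
  (* Double counting: three triples through every point would give [3 * #|Y| <= 3 * #|J|], against
     [#|J| + 2 <= #|Y|]. *)
  have : \sum_(x in Y) 3 <= \sum_(x in Y) #|[set i in J | x \in S i]|.
    by apply: leq_sum => x /big; rewrite -ltnNge.
  have -> : \sum_(x in Y) #|[set i in J | x \in S i]| = \sum_(i in J) #|S i|.
    under eq_bigr => x _ do rewrite -sum1dep_card big_mkcondr /=.
    rewrite exchange_big /=; apply: eq_bigr => i iJ.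
    rewrite -big_mkcondr /= -sum1_card; apply: eq_bigl => x.
    by case: (boolP (x \in S i)) => [/(subsetP (SY i iJ)) ->|]; rewrite ?andbF.
  rewrite (eq_bigr _ S3) !sum_nat_const.
  have J0 : J != set0 by apply/set0Pn; exists i0.
  have /hallP/(_ J (subxx J) J0) hU := hJ.
  have /subset_leq_card/(leq_trans hU) : \bigcup_(i in J) S i \subset Y by apply/bigcupsP.
  by lia.
set D := [set i in J | x \in S i] in deg2.
have inD i : i \in J -> x \in S i -> i \in D by move=> iJ xi; rewrite inE iJ.
have ex_c (Z : {set X}) : 1 < #|Z| -> exists2 c, c \in Z & x != c.
  move=> Z1; have /set0Pn[c] : Z :\ x != set0.
    by rewrite -card_gt0; have := cardsD1 x Z; case: (x \in Z); lia.
  by rewrite !inE eq_sym => /andP[]; exists c.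
(* If every triple through [x] contains [c], the remaining triples avoid [x], so no tight
   obstruction can have [x] in its union. *)
have easy c : c \in Y -> x != c ->
    {in D &, forall i j, i = j} -> {in D, forall i, c \in S i} ->
  exists x c, contractible Y J S x c.
  move=> cY xc D1 Dc; exists x, c; split=> //.
    by move=> i j; rewrite !inE => /and3P[iJ xi _] /and3P[jJ xj _]; apply: D1; apply: inD.
  have sub : [set i in J | ~~ ((x \in S i) && (c \in S i))] \subset J.
    by apply/subsetP=> i; rewrite inE => /andP[].
  have [//|[K [KJ]]] := hall_merge (hallS sub hJ) xc.
  case/bigcupP=> i iK xi; have := subsetP KJ i iK; rewrite inE xi => /andP[iJ].
  by rewrite Dc // inD.
have [D0|[i1 i1D]] := set_0Vmem D.
  have [c cY xc] := ex_c Y (ltnW Y3).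
  by apply: (easy c); rewrite // D0 => i; rewrite inE.
have /setIdP[i1J xi1] := i1D.
have [|c1 c1S xc1] := ex_c (S i1); first by rewrite S3.
have [DE|[i2 i2D]] := set_0Vmem (D :\ i1).
  have DE1 i : i \in D -> i = i1.
    move=> iD; apply/eqP/negPn/negP => ni1.
    by have := in_set0 i; rewrite -DE in_setD1 ni1 iD.
  apply: (easy c1) => //; first exact: (subsetP (SY _ i1J)).
    by move=> i j /DE1-> /DE1->.
  by move=> i /DE1->.
have [ni21 i2D'] : i2 != i1 /\ i2 \in D by move: i2D; rewrite in_setD1 => /andP[].
have /setIdP[i2J xi2] := i2D'.
have ni12 : i1 != i2 by rewrite eq_sym.
have DE i : i \in J -> x \in S i -> i = i1 \/ i = i2.
  move=> iJ xi; have : [set i1; i2] == D.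
    by rewrite eqEcard subUset !sub1set i1D i2D' cards2 eq_sym ni21.
  by move/eqP/setP/(_ i); rewrite (inD i) // !inE => /orP[]/eqP ->; [left|right].
(* Only [S i2] contains both [x] and [d]. An obstruction to merging them avoids [i2] but must cover
   [x], so it contains [i1]. *)
have attempt d : d \in S i2 -> d \notin S i1 ->
    (exists x c, contractible Y J S x c)
  \/ exists K, [/\ K \subset J :\ i2, i1 \in K, d \in \bigcup_(i in K) S i
       & #|\bigcup_(i in K) S i| <= #|K| + 2].
  move=> d2 d1.
  have xd : x != d by apply: contraNneq d1 => <-.
  have J0E : [set i in J | ~~ ((x \in S i) && (d \in S i))] = J :\ i2.
    apply/setP=> i; rewrite !inE andbC; case: (boolP (i \in J)) => iJ; rewrite ?andbF //= !andbT.
    apply/idP/idP; first by apply: contraNneq => ->; rewrite xi2 d2.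
    by apply: contraNN => /andP[/DE[]// ->]; rewrite ?(negPf d1).
  have [h|[K [KJ]]] := hall_merge (hallS (subD1set J i2) hJ) xd.
    left; exists x, d; rewrite /contractible J0E h; split=> //; first exact: (subsetP (SY _ i2J)).
    move=> i j; rewrite !inE => /and3P[iJ xi di] /and3P[jJ xj dj].
    have aux k : k \in J -> x \in S k -> d \in S k -> k = i2.
      by move=> kJ /DE[]// -> dk; rewrite dk in d1.
    by rewrite (aux i) // (aux j).
  case/bigcupP=> i iK xi dK tK; right; exists K; split=> //.
  have := subsetP KJ i iK; rewrite in_setD1 => /andP[ni iJ].
  by have [<-//|ie] := DE i iJ xi; rewrite ie eqxx in ni.
(* A tight [K] avoiding [i2] whose union contains [S i2] contradicts Hall's
   condition for [i2 |: K]. *)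
have absurd K : K \subset J :\ i2 -> #|\bigcup_(i in K) S i| <= #|K| + 2 ->
    ~~ (S i2 \subset \bigcup_(i in K) S i).
  move=> KJ tK; apply/negP=> s2.
  have /andP[KJ' i2K] : (K \subset J) && (i2 \notin K) by rewrite -subsetD1.
  have /hallP/(_ (i2 |: K)) := hJ; rewrite subUset sub1set i2J KJ' => /(_ isT).
  have -> : i2 |: K != set0 by apply/set0Pn; exists i2; rewrite !inE eqxx.
  move/(_ isT); rewrite big_setU1 //= cardsU1 i2K (setUidPr s2).
  by move/leq_trans/(_ tK); rewrite add1n addSn ltnn.
(* Hall's condition for [[set i1; i2]] demands four points, so [S i2] is not inside [S i1]. *)
have [d d2 d1] : exists2 d, d \in S i2 & d \notin S i1.
  apply/subsetPn/negP=> s21; have /hallP/(_ [set i1; i2]) := hJ.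
  rewrite subUset !sub1set i1J i2J => /(_ isT).
  have -> : [set i1; i2] != set0 by apply/set0Pn; exists i1; rewrite !inE eqxx.
  move/(_ isT); rewrite big_setU1 ?inE ?(negPf ni12) //= big_set1 (setUidPl s21) S3 //.
  by rewrite cards2 eq_sym ni21.
have [//|[K [KJ i1K dK tK]]] := attempt d d2 d1.
have sub1 L : i1 \in L -> S i1 \subset \bigcup_(i in L) S i by move=> i1L; apply: bigcup_sup.
(* The second candidate is a point of [S i2] missed by the tight [K]; it is outside [S i1] because
   [i1 \in K]. *)
have [c [c2 cK]] : exists c, c \in S i2 /\ c \notin \bigcup_(i in K) S i.
  by have /subsetPn[c] := absurd K KJ tK; exists c.
have cN1 : c \notin S i1 by apply: contraNN cK; apply/subsetP; apply: sub1.
have [//|[L [LJ i1L cL tL]]] := attempt c c2 cN1.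
(* [K] and [L] share [i1], so [K :|: L] is tight; it covers [x] through [S i1], [d] through [K] and
   [c] through [L], which is all of [S i2]. *)
have := absurd (K :|: L); rewrite subUset KJ LJ => /(_ isT).
have -> : #|\bigcup_(i in K :|: L) S i| <= #|K :|: L| + 2.
  apply: tightU (hallS (subD1set J i2) hJ) KJ LJ _ tK tL.
  by apply/set0Pn; exists i1; rewrite inE i1K.
move/(_ isT)/negP; case; rewrite bigcup_setU.
have xd : x != d by apply: contraNneq d1 => <-.
have xc : x != c by apply: contraNneq cN1 => <-.
have dc : d != c by apply: contraNneq cK => <-.
have -> : S i2 = [set x; d; c].
  apply/esym/eqP; rewrite eqEcard !subUset !sub1set xi2 d2 c2 S3 //=.
  by rewrite -setUA cardsU1 cards2 !inE negb_or xd xc dc.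
rewrite !subUset !sub1set !in_setU dK cL orbT !andbT.
by rewrite (subsetP (sub1 K i1K)).
Qed.
End Contraction.

(** * Growing a cubic tree with prescribed leaves and distinct medians *)

Section Realization.
Variables (X I : finType).
Implicit Types (Y : {set X}) (J : {set I}) (S : I -> {set X}).

(** The median [m i] is specified by the paths through it, which avoids the option type of [med].
    Injectivity of [f] is asked only on [Y], which shrinks in the induction while [X] stays
    fixed. *)
Definition realizes Y J S (V : finType) (e : rel V) (f : X -> V) (m : I -> V) : Prop :=
  [/\ is_tree e, {in Y &, injective f},
      f @: Y = leaves e /\ {in interior e, forall v, degree e v = 3},
      {in J, forall i, {in S i &, forall a b, a != b -> on_path e (f a) (f b) (m i)}}
    & {in J &, injective m}].

Lemma realizes_interior Y J S (V : finType) (e : rel V) f m i :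
    realizes Y J S e f m -> i \in J -> S i \subset Y -> #|S i| = 3 ->
  m i \in interior e.
Proof.
case=> treeV finj _ fm _ iJ SY S3.
apply: (triple_median treeV (S := f @: S i)).
  by rewrite card_in_imset //; apply: sub_in2 finj; apply/subsetP.
move=> _ _ /imsetP[a aS ->] /imsetP[b bS ->] ab; apply: fm => //.
by apply: contraNneq ab => ->.
Qed.

(** The tree is a single edge on [bool]; both vertices are leaves, so the degree condition is
    vacuous. *)
Lemma realizes_edge Y S : #|Y| = 2 -> exists (V : finType) (e : rel V) f m,
  realizes Y set0 S e f m.
Proof.
move=> /eqP/cards2P[x [y [xy ->]]].
pose e : rel bool := fun a b => a != b.
have deg v : degree e v = 1.
  by rewrite /degree -[RHS](cards1 (~~ v)); apply: eq_card => -[]; case: v; rewrite !inE.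
exists bool, e, (pred1 x), (fun=> true); split.
- split=> [[] []|[]|a b|c /andP[_ /card_uniqP <-]] //.
    by have [->|ab] := eqVneq a b; [exact: connect0 | exact: connect1].
  by apply: leq_ltn_trans (max_card _) _; rewrite card_bool.
- move=> a b; rewrite !inE => /orP[]/eqP-> /orP[]/eqP-> //=; rewrite eqxx.
    by rewrite eq_sym (negPf xy).
  by rewrite eq_sym (negPf xy).
- split=> [|v]; last by rewrite !inE deg.
  apply/setP=> v; rewrite !inE deg eqxx imsetU1 imset_set1 !inE /= eqxx eq_sym (eq_sym y).
  by rewrite (negPf xy); case: v.
- by move=> i; rewrite inE.
- by move=> i j; rewrite inE.
Qed.

Lemma realizes_cherry Y J S x c (V : finType) (e : rel V) f m :
    contractible Y J S x c -> {in J, forall i, #|S i| = 3} ->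
    {in J, forall i, S i \subset Y} ->
    realizes (Y :\ x) [set i in J | ~~ ((x \in S i) && (c \in S i))]
      (fun i => merge x c @: S i) e f m ->
  realizes Y J S (cherry e (f c))
    (fun y => if y == x then None else if y == c then Some None else Some (Some (f y)))
    (fun i => Some (Some (if (x \in S i) && (c \in S i) then f c else m i))).
Proof.
case=> xY cY xc Juniq _ S3 SY real; have [treeV finj [fY deg3] fm minj] := real.
set J0 := [set i in J | _] in real fm minj.
pose f' y := if y == x then None else if y == c then Some None else Some (Some (f y)).
rewrite -/f'.
have collapseE y : collapse (f c) (f' y) = f (merge x c y).
  by rewrite /f' /merge; case: eqP => // _; case: eqP => [->|].
have cY' : c \in Y :\ x by rewrite !inE eq_sym xc.
have finj' : {in Y &, injective f'}.
  move=> a b aY bY; rewrite /f'; have [->|ax] := eqVneq a x; have [->|bx] := eqVneq b x => //.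
    by case: ifP.
    by case: ifP.
  have [->|ac] := eqVneq a c; have [->|bc] := eqVneq b c => //.
  by case=> /finj -> //; rewrite in_setD1 ?ax ?bx.
have leafc : f c \in leaves e by rewrite -fY imset_f.
have mint i : i \in J0 -> m i \in interior e.
  move=> iJ0; have /setIdP[iJ xci] := iJ0.
  apply: (realizes_interior real) => //; last first.
    by rewrite card_in_imset ?S3 //; apply: merge_inj_in.
  apply/subsetP=> _ /imsetP[y yS ->]; rewrite /merge; case: eqP => // /eqP yx.
  by rewrite in_setD1 yx (subsetP (SY i iJ)).
(* Old medians are interior and [f c] is an old leaf, so giving [f c] to the deleted triple keeps
   [m] injective. *)
have mNc i : i \in J0 -> m i != f c.
  by move=> /mint; apply: contraTneq => ->; rewrite inE negbK.
split.
- exact: cherry_tree.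
- exact: finj'.
- have deg1 : degree e (f c) = 1 by move: leafc; rewrite inE => /eqP.
  split=> [|u]; last first.
    rewrite !inE cherry_deg; case: u => [[v|]|] //.
    (* The old leaf [f c] gains two edges, reaching degree 1 + 2 = 3. *)
    have [->|_] := eqVneq v (f c); first by rewrite deg1.
    by rewrite addn0 => v1; apply: deg3; rewrite !inE.
  apply/setP=> u; rewrite inE cherry_deg; case: u => [[v|]|].
  + have [->|vc] := eqVneq v (f c).
      rewrite deg1; apply/negP=> /imsetP[y yY]; rewrite /f'; case: eqP => // /eqP yx.
      case: eqP => // /eqP yc [] /esym fyc; case/eqP: yc.
      by apply: finj; rewrite // in_setD1 yx.
    have -> : (degree e v + false.*2 == 1) = (v \in f @: (Y :\ x)).
      by rewrite addn0 fY inE.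
    apply/imsetP/imsetP=> -[y yY].
      rewrite /f'; case: eqP => // /eqP yx; case: eqP => // _ [->].
      by exists y; rewrite // in_setD1 yx.
    move: yY; rewrite in_setD1 => /andP[yx yY] vE; exists y => //.
    by rewrite /f' (negPf yx); case: eqP => [yc|_]; [rewrite vE yc eqxx in vc | rewrite vE].
  + by rewrite eqxx; apply/imsetP; exists c; rewrite // /f' eq_sym (negPf xc) eqxx.
  + by rewrite eqxx; apply/imsetP; exists x; rewrite // /f' eqxx.
- move=> i iJ a b aS bS ab /=; rewrite cherry_on_path //; last first.
    by apply: contraNneq ab => /finj' ->; rewrite ?(subsetP (SY i iJ)).
  rewrite !collapseE; case: ifP => [/andP[xS cS]|/negbT nS]; last first.
    apply: fm; rewrite ?imset_f ?inE ?iJ //.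
    by apply: contraNneq ab => /(merge_inj_in nS) ->.
  (* Of two distinct points of the deleted triple, at least one is [x] or [c] and collapses to
     [f c], so [f c] is an end of the collapsed path. *)
  have [y [z [xcE]]] : exists y z, [/\ y = c, x != z & S i = [set x; c; z]].
    have [y [z [xy xz yz SE]]] := cards3E (S3 i iJ) xS.
    have := cS; rewrite SE !inE eq_sym (negPf xc) /= => /orP[]/eqP ce.
      by exists y, z; rewrite ce.
    by exists z, y; rewrite ce setUAC.
  move=> xz SE.
  have [mac|mac] := eqVneq (merge x c a) c; first by rewrite mac on_path_left.
  have [mbc|mbc] := eqVneq (merge x c b) c; first by rewrite mbc on_path_right.
  have isz w : w \in S i -> merge x c w != c -> w = z.
    rewrite SE !inE /merge -orbA => /or3P[]/eqP-> //; rewrite ?eqxx //.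
    by case: ifP; rewrite eqxx.
  by rewrite (isz a) // (isz b) // eqxx in ab.
- move=> i j iJ jJ [].
  have inJ0 k : k \in J -> ((x \in S k) && (c \in S k)) = false -> k \in J0.
    by move=> kJ xck; rewrite inE kJ xck.
  case: ifP => xi; case: ifP => xj.
  + by move=> _; apply: Juniq; rewrite inE ?iJ ?jJ.
  + by move/esym/eqP; rewrite (negPf (mNc _ _)) ?inJ0.
  + by move/eqP; rewrite (negPf (mNc _ _)) ?inJ0.
  + by apply: minj; apply: inJ0.
Qed.

Lemma hall_realizes Y J S : 1 < #|Y| -> {in J, forall i, #|S i| = 3} ->
    {in J, forall i, S i \subset Y} -> hall J S ->
  exists (V : finType) (e : rel V) f m, realizes Y J S e f m.
Proof.
move En: #|Y| => [|[|n]] // _; elim: n Y J S En => [|n IHn] Y J S Yn S3 SY hJ.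
  (* With two points in [Y] no triple fits, so the family is empty. *)
  rewrite (_ : J = set0); first exact: realizes_edge.
  apply/setP=> i; rewrite inE; apply/negP => iJ.
  by have := subset_leq_card (SY i iJ); rewrite S3 // Yn.
have [|x [c con]] := @hall_contract _ _ Y J S _ S3 SY hJ; first by rewrite Yn.
have [xY cY xc _ hJ0] := con.
have Yx : #|Y :\ x| = n.+2 by have := cardsD1 x Y; rewrite Yn xY add1n => -[].
have [i /setIdP[iJ xci]|i /setIdP[iJ xci]|V [e [f [m real]]]] :=
  (fun cardS subS => IHn _ _ _ Yx cardS subS hJ0).
- by rewrite card_in_imset ?S3 //; apply: merge_inj_in.
- apply/subsetP=> _ /imsetP[y yS ->]; rewrite /merge; case: eqP => [_|/eqP yx].
    by rewrite !inE eq_sym xc.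
  by rewrite in_setD1 yx (subsetP (SY i iJ)).
- exists (option (option V)), (cherry e (f c)); do 2!eexists.
  apply: realizes_cherry con S3 SY real.
Qed.
End Realization.

(** * Equivalence of the three statements, with [X] embedded in the vertices by [f] *)

Theorem theorem1p1 (X : finType) (C : {set {set X}})
    (hC : forall S : {set X}, S \in C -> #|S| = 3)
    (coverC : cover C = [set: X]) :
  [<-> exists (V : finType) (e : rel V) (f : X -> V),
         [/\ is_tree e, injective f
           & {in C &, injective (fun S : {set X} => med e (f @: S))}];
       exists (V : finType) (e : rel V) (f : X -> V),
         [/\ is_tree e, injective f,
             f @: [set: X] = leaves e
             /\ (forall v : V, v \notin leaves e -> degree e v = 3),
             (forall S : {set X}, S \in C ->
                exists2 v, v \in interior e & med e (f @: S) = Some v)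
           & {in C &, injective (fun S : {set X} => med e (f @: S))}];
       forall C' : {set {set X}}, C' \subset C -> C' != set0 ->
         #|C'| + 2 <= #|cover C'|].
Proof.
set P1 := (P in [<-> P; _; _]); set P2 := (P in [<-> _; P; _]).
set P3 := (P in [<-> _; _; P]).
have H21 : P2 -> P1.
  by case=> V [e [f [treeV finj _ _ minj]]]; exists V, e, f.
have H13 : P1 -> P3.
  case=> V [e [f [treeV finj minj]]] C' sC' C'0.
  pose fS (S : {set X}) := f @: S.
  have -> : #|cover C'| = #|cover (fS @: C')|.
    rewrite -(card_imset _ finj) /cover big_imset /=; last first.
      by move=> A B _ _; apply: imset_inj.
    by rewrite (big_morph _ (imsetU f) (imset0 f)).
  rewrite -(card_imset (mem C') (imset_inj finj)); apply: (card_med_injective treeV).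
  - by case/set0Pn: C'0 => S SC; apply/set0Pn; exists (fS S); apply: imset_f.
  - by move=> _ /imsetP[S SC ->]; rewrite card_imset // hC // (subsetP sC').
  - move=> _ _ /imsetP[S SC ->] /imsetP[T TC ->] /minj -> //; exact: (subsetP sC').
have H32 : P3 -> P2.
  (* An empty [C] forces [X] to be empty, and the graph without vertices serves; otherwise a triple
     supplies the points that [hall_realizes] requires. *)
  move=> hall3; have [C0|[S0 S0C]] := set_0Vmem C.
    have noX (x : X) : False by have := in_setT x; rewrite -coverC C0 /cover big_set0 inE.
    exists void, (fun _ _ => false), (fun x => False_rect _ (noX x)).
    split; [by split=> [[]|[]|[]|[|[]]] | by move=> x; have := noX x | split=> [|[]] | |].
    - by apply/setP=> -[].
    - by move=> S; rewrite C0 inE.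
    - by move=> S T; rewrite C0 inE.
  have hJ : hall C id by apply/hallP.
  have [||V [e [f [m real]]]] := @hall_realizes _ _ [set: X] C id _ hC _ hJ.
  - by apply: leq_trans (subset_leq_card (subsetT S0)); rewrite hC.
  - by move=> S _; apply: subsetT.
  have [treeV finj [fX deg3] fm minj] := real.
  have finjT : injective f by move=> x y; apply: finj; rewrite inE.
  (* [m S] lies on all paths between points of [f @: S], and the median is unique. *)
  have medE S : S \in C -> med e (f @: S) = Some (m S).
    move=> SC; have [|v -> medv] := med_tree treeV (S := f @: S); first by rewrite card_imset ?hC.
    congr Some; apply/esym/eqP; rewrite -medv; apply/forall_inP=> _ /imsetP[a aS ->].
    apply/forall_inP=> _ /imsetP[b bS ->]; apply/implyP=> ab.
    by apply: fm => //; apply: contraNneq ab => ->.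
  exists V, e, f; split=> //.
  - by split=> // v vL; apply: deg3; rewrite inE.
  - move=> S SC; exists (m S); last exact: medE.
    exact: realizes_interior real SC (subsetT S) (hC S SC).
  - by move=> S T SC TC /=; rewrite !medE // => -[]; apply: minj.
(* The cycle to close is (1) => (2) => (3) => (1), each arrow composed of two of the implications
   above. *)
by split; [move=> /H13/H32 | split; [move=> /H21/H13 | move=> /H32/H21]].
Qed.
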